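(* Let $q_\varepsilon(t)$ be a space change of the trajectory $t\mapsto q(t)$, $t\in I$, and $G(\varepsilon,t)$ a BH-function. Suppose that there is infinitesimal BH-invariance under the space change $q_\varepsilon$ with BH-function $G$, and that $q(t)=q_0(t)$ is a solution to the Lagrange equation. Then the function $$t\mapsto\partial_{\dot q}L\bigl(t,q(t),\dot q(t)\bigr)\cdot\partial_\varepsilon q_\varepsilon(t)\big|_{\varepsilon=0}+\partial_\varepsilon G(\varepsilon,t)\big|_{\varepsilon=0}$$ is constant in $t\in I$.
   Context: Let $n\ge1$ and let $L=L(t,q,\dot q)$ (the Lagrangian) be a smooth real-valued function on an open subset of $\mathbb{R}\times\mathbb{R}^n\times\mathbb{R}^n$. The symbols $\partial_qL,\partial_{\dot q}L$ denote the gradients with respect to the second and third arguments, viewed as vectors of $\mathbb{R}^n$; $x\cdot y$ is the Euclidean inner product; a dot over a function denotes the derivative in $t$. Let $t\mapsto q(t)\in\mathbb{R}^n$ be a smooth trajectory on an open interval $I$ such that $(t,q(t),\dot q(t))$ lies in the domain of $L$ for all $t\in I$. It is a solution to the Lagrange equation if $\frac{d}{dt}\partial_{\dot q}L(t,q(t),\dot q(t))-\partial_qL(t,q(t),\dot q(t))=0$ for all $t\in I$. All functions of $(\varepsilon,t)$ below are defined on an open neighbourhood of $\{0\}\times I$ in $\mathbb{R}\times I$ (i.e. for $t\in I$ and $\varepsilon$ close to $0$). A space change of $q$ is a smooth one-parameter family $(\varepsilon,t)\mapsto q_\varepsilon(t)\in\mathbb{R}^n$ with $q_0(t)=q(t)$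 for all $t\in I$. A BH-function is a smooth real function $G(\varepsilon,t)$. The Hamiltonian action is $A_{a,b}(q)=\int_a^bL(t,q(t),\dot q(t))\,dt$. Infinitesimal BH-invariance under the space change $q_\varepsilon$ with BH-function $G$ means $$\frac{\partial}{\partial\varepsilon}\Bigl(A_{a,b}(q_\varepsilon)+G(\varepsilon,b)-G(\varepsilon,a)\Bigr)\Big|_{\varepsilon=0}=0\quad\forall a,b\in I,$$ equivalently $\frac{\partial}{\partial\varepsilon}\bigl(L(t,q_\varepsilon(t),\dot q_\varepsilon(t))+\partial_tG(\varepsilon,t)\bigr)\big|_{\varepsilon=0}=0$ for all $t\in I$. *)

(* Defs.v *)
From HB Require Import structures.
From mathcomp Require Import all_boot all_order all_algebra.
From mathcomp Require Import all_classical all_reals all_analysis.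

Set Implicit Arguments.
Unset Strict Implicit.
Unset Printing Implicit Defensive.

Import Order.TTheory GRing.Theory Num.Theory.
Import numFieldNormedType.Exports.

Local Open Scope ring_scope.
Local Open Scope classical_set_scope.

Section Smooth.
Context {R : realType} {V W : normedModType R}.

(* Meant for V finite-dimensional and D open.  There, f is C^k iff it is
   differentiable with C^(k-1) directional derivatives, and the values of f
   outside D are irrelevant. *)
Fixpoint Ck_on (k : nat) (D : set V) (f : V -> W) : Prop :=
  match k with
  | 0%N => forall x, D x -> {for x, continuous f}
  | k'.+1 => (forall x, D x -> differentiable f x) /\
             (forall v, Ck_on k' D ('D_v f))
  end.

Definition smooth_on (D : set V) (f : V -> W) : Prop :=
  forall k, Ck_on k D f.

End Smooth.

Section Lagrangian.
Context {R : realType} {n : nat}.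

Definition gradient (f : 'rV[R]_n -> R) (x : 'rV[R]_n) : 'rV[R]_n :=
  \row_(i < n) 'D_(delta_mx 0 i) f x.

Definition dotv (x y : 'rV[R]_n) : R := \sum_(i < n) x 0 i * y 0 i.

(* int_a^b f, equal to - int_b^a f when b < a *)
Definition oriented_integral (a b : R) (f : R -> R) : R :=
  if a <= b then (\int[@lebesgue_measure R]_(t in `[a, b]) f t)%R
  else - (\int[@lebesgue_measure R]_(t in `[b, a]) f t)%R.

(* L is a function of (t, q, v), where v stands for the velocity. *)
Implicit Types (L : R * 'rV[R]_n * 'rV[R]_n -> R) (q : R -> 'rV[R]_n).

Definition dL_q L (t : R) (x v : 'rV[R]_n) : 'rV[R]_n :=
  gradient (fun y => L (t, y, v)) x.

Definition dL_v L (t : R) (x v : 'rV[R]_n) : 'rV[R]_n :=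
  gradient (fun w => L (t, x, w)) v.

Definition is_trajectory (D : set (R * 'rV[R]_n * 'rV[R]_n)) (I : set R) q :
    Prop :=
  smooth_on I q /\ (forall t, I t -> D (t, q t, derive1 q t)).

Definition lagrange_solution L (I : set R) q : Prop :=
  forall t, I t ->
    derive1 (fun s => dL_v L s (q s) (derive1 q s)) t
      - dL_q L t (q t) (derive1 q t) = 0.

Definition open_nbhd_0xI (I : set R) (O : set (R * R)) : Prop :=
  [/\ open O, [set 0] `*` I `<=` O & O `<=` setT `*` I].

Definition space_change (I : set R) q (qe : R -> R -> 'rV[R]_n) : Prop :=
  (exists O, open_nbhd_0xI I O /\ smooth_on O (fun p => qe p.1 p.2)) /\
  (forall t, I t -> qe 0 t = q t).

Definition BH_function (I : set R) (G : R -> R -> R) : Prop :=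
  exists O, open_nbhd_0xI I O /\ smooth_on O (fun p => G p.1 p.2).

Definition action L (a b : R) q : R :=
  oriented_integral a b (fun t => L (t, q t, derive1 q t)).

(* For a, b in I and eps close to 0, the curve qe eps is smooth on the segment
   between a and b and its lift stays in the domain of L, so that
   action L a b (qe eps) only involves meaningful values. *)
Definition infinitesimal_BH_invariance L (I : set R) (qe : R -> R -> 'rV[R]_n)
    (G : R -> R -> R) : Prop :=
  forall a b, I a -> I b ->
    is_derive (0 : R) 1
      (fun eps => action L a b (qe eps) + G eps b - G eps a) 0.

End Lagrangian.

(* Main.v *)
Require Import Defs.
From HB Require Import structures.
From mathcomp Require Import all_boot all_order all_algebra.
From mathcomp Require Import all_classical all_reals all_analysis.
From mathcomp Require Import ring.
Import Order.TTheory GRing.Theory Num.Theory.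
Import numFieldNormedType.Exports.
Local Open Scope ring_scope.
Local Open Scope classical_set_scope.

Set Implicit Arguments.
Unset Strict Implicit.

(** The momentum m(t) = dL_v . (d/d eps) q_eps at eps = 0 measures the first
    variation of the action on every segment [a, b] of I:

      (d/d eps) A_{a,b}(q_eps) at 0  =  m(b) - m(a).

    Infinitesimal BH-invariance says that this derivative is the opposite of
    the increment of (d/d eps) G between a and b, so m + (d/d eps) G takes the
    same value at a and at b.

    To obtain the displayed formula, write Q(eps, t) = q_eps(t) and compose L
    with the lift (t, Q, dQ/dt) of Q, called [jet Q] below, a map of two real
    variables.  The chain rule gives (lemma [first_variation])

      (d/d eps) L(jet Q)  =  dL_q . (dQ/d eps) + dL_v . (d/d eps) (dQ/dt).

    At eps = 0 the Lagrange equation replaces dL_q by (d/dt) dL_v, and the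
    mixed partial derivatives of Q commute (lemma [schwarz_row]), so the
    right-hand side is the time derivative of m (lemma [is_derive_momentum]).
    It remains to differentiate the action under the integral sign
    ([is_derive_integral]) and to apply the fundamental theorem of calculus
    ([is_derive_action]).

    The domain where L(jet Q) is differentiable is only known to be a
    neighbourhood of {0} x I, not a product; compactness of [a, b] gives the
    strip around {0} x [a, b] that differentiation under the integral needs. *)

(** * Directional derivatives along slices, pairs and compositions *)

Section Slices.
Context {R : realType} {U V W : normedModType R}.

(** When g runs along the line of direction v, the difference quotients of
    f \o g are those of f itself.  No chain rule is involved: derivability of f
    in the single direction v is enough, where a composition lemma would ask
    for differentiability. *)
Lemma is_derive_affine (f : V -> W) (g : U -> V) (a u : U) (v : V) :
  (forall h : R, g (h *: u + a) = h *: v + g a) ->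
  derivable f (g a) v -> is_derive a u (fun x => f (g x)) ('D_v f (g a)).
Proof.
move=> gE fv; split; first by rewrite /derivable /=; under eq_fun do rewrite gE.
by rewrite /derive /=; under eq_fun do rewrite gE.
Qed.

(** The two limits are the same expression, hence equal even where they do not
    exist.  This identifies the partial derivatives in the definition of the
    action with directional derivatives at every point. *)
Lemma derive_affine (f : V -> W) (g : U -> V) (a u : U) (v : V) :
  (forall h : R, g (h *: u + a) = h *: v + g a) ->
  'D_u (fun x => f (g x)) a = 'D_v f (g a).
Proof. by move=> gE; rewrite /derive /=; under eq_fun do rewrite gE. Qed.

End Slices.

Section PlaneSlices.
Context {R : realType}.
Local Notation eps_dir := ((1, 0) : R * R).
Local Notation t_dir := ((0, 1) : R * R).

Lemma derive_fst_slice (W : normedModType R) (f : R * R -> W) (e t : R) :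
  (fun x => f (x, t))^`() e = 'D_eps_dir f (e, t).
Proof.
rewrite derive1E; apply: (derive_affine f (g := fun x : R => (x, t))) => h.
by congr (_, _); rewrite /= scaler0 add0r.
Qed.

Lemma is_derive_fst_slice (W : normedModType R) (f : R * R -> W) (e t : R) :
  derivable f (e, t) eps_dir ->
  is_derive e 1 (fun x => f (x, t)) ('D_eps_dir f (e, t)).
Proof.
apply: (is_derive_affine (f := f) (g := fun x : R => (x, t))) => h.
by congr (_, _); rewrite /= scaler0 add0r.
Qed.

Lemma is_derive_snd_slice (W : normedModType R) (f : R * R -> W) (e t : R) :
  derivable f (e, t) t_dir ->
  is_derive t 1 (fun s => f (e, s)) ('D_t_dir f (e, t)).
Proof.
apply: (is_derive_affine (f := f) (g := fun x : R => (e, x))) => h.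
by congr (_, _); rewrite /= scaler0 add0r.
Qed.

Lemma derive_snd_slice (W : normedModType R) (f : R * R -> W) (e t : R) :
  (fun s => f (e, s))^`() t = 'D_t_dir f (e, t).
Proof.
rewrite derive1E; apply: (derive_affine f (g := fun x : R => (e, x))) => h.
by congr (_, _); rewrite /= scaler0 add0r.
Qed.

End PlaneSlices.

Section Pair.
Context {R : realType} {U V W : normedModType R}.

Lemma derive_pair (f : U -> V) (g : U -> W) (x u : U) :
  differentiable f x -> differentiable g x ->
  'D_u (fun y => (f y, g y)) x = ('D_u f x, 'D_u g x).
Proof.
move=> df dg; rewrite deriveE; last exact: differentiable_pair.
by rewrite diff_pair// !deriveE.
Qed.

Lemma derive_comp (f : U -> V) (g : V -> W) (x u : U) :
  differentiable f x -> differentiable g (f x) ->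
  'D_u (fun y => g (f y)) x = 'D_('D_u f x) g (f x).
Proof.
move=> df dg; rewrite (deriveE u (differentiable_comp df dg)).
by rewrite diff_comp// !deriveE.
Qed.

End Pair.

(** * Row vectors and their inner product *)

Section Rows.
Context {R : realType} {V : normedModType R}.

Lemma is_derive_row n (x : V -> 'rV[R]_n) (x' : 'rV[R]_n) t v :
  is_derive t v x x' <->
  forall i, is_derive t v (fun s => x s 0 i) (x' 0 i).
Proof.
split=> [[dx <-] i|dxi].
  split; first by move/derivable_mxP : dx => /(_ 0 i).
  by rewrite derive_mx// mxE.
have dx : derivable x t v.
  by apply/derivable_mxP => i j; rewrite ord1; have [] := dxi j.
split=> //; rewrite derive_mx//; apply/rowP => i; rewrite mxE.
by have [_] := dxi i.
Qed.

Lemma cvg_coord n (T : Type) (F : set_system T) (FF : Filter F)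
    (x : T -> 'rV[R]_n) (l : 'rV[R]_n) i :
  x @ F --> l -> x t 0 i @[t --> F] --> l 0 i.
Proof.
move=> xl; apply: (cvg_comp x (fun y : 'rV[R]_n => y 0 i) xl).
exact: coord_continuous.
Qed.

End Rows.

Section Dot.
Context {R : realType} {n : nat}.

Lemma is_derive_dotv (V : normedModType R) (x y : V -> 'rV[R]_n)
    (x' y' : 'rV[R]_n) (t v : V) :
  is_derive t v x x' -> is_derive t v y y' ->
  is_derive t v (fun s => dotv (x s) (y s)) (dotv x' (y t) + dotv (x t) y').
Proof.
move=> /is_derive_row dx /is_derive_row dy.
have -> : (fun s => dotv (x s) (y s)) =
    \sum_(i < n) ((fun s => x s 0 i) * (fun s => y s 0 i)).
  by apply/funext => s; rewrite fct_sumE.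
have dxy i : is_derive t v ((fun s => x s 0 i) * (fun s => y s 0 i))
    (x t 0 i *: y' 0 i + y t 0 i *: x' 0 i).
  exact: is_deriveM.
apply: (is_derive_eq (is_derive_sum dxy)).
rewrite /dotv -big_split /=; apply: eq_bigr => i _.
by rewrite addrC; congr (_ + _); rewrite mulrC.
Qed.

Lemma cvg_dotv (T : Type) (F : set_system T) (FF : Filter F)
    (x y : T -> 'rV[R]_n) (a b : 'rV[R]_n) :
  (forall i, x t 0 i @[t --> F] --> a 0 i) ->
  (forall i, y t 0 i @[t --> F] --> b 0 i) ->
  dotv (x t) (y t) @[t --> F] --> dotv a b.
Proof.
move=> xa yb; apply: cvg_big => [|i _]; first exact: add_continuous.
by apply: cvgM; [exact: xa|exact: yb].
Qed.

End Dot.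

(** * Symmetry of second derivatives *)

Section Schwarz.
Context {R : realType} {V : normedModType R}.

Lemma MVT_direction (f : V -> R) (p u : V) (h : R) : 0 < h ->
  (forall s, s \in `[0, h]%R -> derivable f (p + s *: u) u) ->
  exists2 s, s \in `[0, h]%R & f (p + h *: u) - f p = 'D_u f (p + s *: u) * h.
Proof.
move=> h0 df.
have dg s : s \in `[0, h]%R ->
    is_derive s 1 (fun s : R => f (p + s *: u)) ('D_u f (p + s *: u)).
  move=> /df dfs.
  apply: (is_derive_affine (f := f) (g := fun s : R => p + s *: u)) dfs => k.
  by rewrite scalerDl [k *: 1]mulr1 addrCA.
pose g (s : R) := f (p + s *: u); pose g' (s : R) := 'D_u f (p + s *: u).
have cg : {within `[0, h], continuous g}.
  by apply: derivable_within_continuous => s /dg [].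
have [s s0h] := @MVT R g g' 0 h h0 (fun s sh => dg s (subset_itv_oo_cc sh)) cg.
rewrite {1}/g {1}/g scale0r addr0 subr0 => E; exists s => //.
exact: subset_itv_oo_cc.
Qed.

(** The mean value theorem applied first to g x = f (x + h *: v) - f x in the
    direction u, then to 'D_u f in the direction v. *)
Lemma second_difference (f : V -> R) (p u v : V) (h : R) : 0 < h ->
  (forall s r, s \in `[0, h]%R -> r \in `[0, h]%R ->
    derivable f (p + s *: u + r *: v) u /\
    derivable ('D_u f) (p + s *: u + r *: v) v) ->
  exists s r, [/\ s \in `[0, h]%R, r \in `[0, h]%R &
    f (p + h *: u + h *: v) - f (p + h *: u) - (f (p + h *: v) - f p) =
    'D_v ('D_u f) (p + s *: u + r *: v) * h * h].
Proof.
move=> h0 df.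
have i0 : 0 \in `[0, h]%R by rewrite in_itv /= lexx ltW.
have ih : h \in `[0, h]%R by rewrite in_itv /= lexx ltW.
pose g x := f (x + h *: v) - f x.
have dg s : s \in `[0, h]%R ->
    is_derive (p + s *: u) u g
      ('D_u f (p + s *: u + h *: v) - 'D_u f (p + s *: u)).
  move=> sh; apply: is_deriveB; last first.
    by apply: derivableP; have [+ _] := df s 0 sh i0; rewrite scale0r addr0.
  apply: (is_derive_affine (f := f) (g := fun x => x + h *: v)).
    by move=> k; rewrite -addrA.
  exact: (df s h sh ih).1.
have [s sh|s sh gE] := @MVT_direction g p u h h0; first by have [] := dg s sh.
have [r rh|r rh fE] := @MVT_direction ('D_u f) (p + s *: u) v h h0.
  exact: (df s r sh rh).2.
exists s, r; split=> //; rewrite -fE.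
by have [_ <-] := dg s sh; rewrite -gE /g addrAC; ring.
Qed.

(** The second difference of f over the parallelogram spanned by h *: u and
    h *: v is symmetric in u and v.  Divided by h ^+ 2, it is a value of each of
    the two mixed derivatives at points of the parallelogram, and by continuity
    both values are close to those at p when h is small. *)
Lemma schwarz_scalar (f : V -> R) (p u v : V) :
  (\forall x \near p, [/\ derivable f x u, derivable f x v,
     derivable ('D_u f) x v & derivable ('D_v f) x u]) ->
  {for p, continuous ('D_v ('D_u f))} -> {for p, continuous ('D_u ('D_v f))} ->
  'D_v ('D_u f) p = 'D_u ('D_v f) p.
Proof.
move=> df cvu cuv; apply/eqP; rewrite -subr_eq0 -normr_le0.
apply/ler_addgt0Pl => e e0; rewrite addr0.
have e20 : 0 < e / 2 by rewrite divr_gt0.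
move/cvgrPdist_le : cvu => /(_ _ e20) cvu.
move/cvgrPdist_le : cuv => /(_ _ e20) cuv.
have /nbhs_normP[d /= d0 dP] : \forall x \near p,
    [/\ derivable f x u, derivable f x v,
     derivable ('D_u f) x v & derivable ('D_v f) x u] /\
    (`|'D_v ('D_u f) p - 'D_v ('D_u f) x| <= e / 2 /\
     `|'D_u ('D_v f) p - 'D_u ('D_v f) x| <= e / 2).
  by apply: filterI; [exact: df|apply: filterI; [exact: cvu|exact: cuv]].
(* With this h, the parallelogram at p lies in the ball of radius d, and the
   + 1 allows u = v = 0. *)
pose h := d / 2 / (`|u| + `|v| + 1).
have uv0 : 0 < `|u| + `|v| + 1 by rewrite ltr_wpDl// addr_ge0.
have h0 : 0 < h by rewrite !divr_gt0.
have hP s r : s \in `[0, h]%R -> r \in `[0, h]%R ->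
    ball_ Num.norm p d (p + s *: u + r *: v).
  rewrite !in_itv /= => /andP[s0 sh] /andP[r0 rh].
  rewrite /ball_ /= opprD opprD !addrA subrr add0r -opprD normrN.
  rewrite (le_lt_trans (ler_normD _ _))// !normrZ !ger0_norm//.
  apply: (@le_lt_trans _ _ (h * (`|u| + `|v| + 1))).
    rewrite mulrDr mulrDr -addrA lerD ?ler_wpM2r//.
    by rewrite ler_wpDr ?mulr1 ?ler_wpM2r// ltW.
  by rewrite /h divfK ?gt_eqF// ltr_pdivrMr// ltr_pMr// ltr1n.
have hP' s r : s \in `[0, h]%R -> r \in `[0, h]%R ->
    ball_ Num.norm p d (p + r *: v + s *: u).
  by rewrite (addrAC p); exact: hP.
have [|s [r [sh rh E1]]] := @second_difference f p u v h h0.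
  by move=> s r sh rh; have [[d1 _ d2 _] _] := dP _ (hP s r sh rh); split.
have [|r' [s' [rh' sh' E2]]] := @second_difference f p v u h h0.
  by move=> r' s' rh' sh'; have [[]] := dP _ (hP' s' r' sh' rh').
(* E1 and E2 compute the same second difference, with its two middle corners
   exchanged. *)
have uncross (a b c z x y : R) :
    a - b - (c - z) = x * h * h -> a - c - (b - z) = y * h * h -> x = y.
  move=> xE yE; apply: (mulIf (lt0r_neq0 h0)); apply: (mulIf (lt0r_neq0 h0)).
  by rewrite -xE -yE; ring.
rewrite (addrAC p (h *: v)) in E2.
have [_ [+ _]] := dP _ (hP s r sh rh).
have [_ [_]] := dP _ (hP' s' r' sh' rh').
rewrite (uncross _ _ _ _ _ _ E1 E2).
move=> uvP vuP; apply: (le_trans (ler_distD _ _ _)).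
rewrite [leRHS]splitr; apply: lerD; first exact: vuP.
by rewrite distrC; exact: uvP.
Unshelve. all: by end_near. Qed.

(** The scalar case applies to each coordinate of f, because taking a
    coordinate commutes with 'D_w near p. *)
Lemma schwarz_row n (O : set V) (f : V -> 'rV[R]_n) (p u v : V) :
  open O -> Ck_on 2 O f -> O p -> 'D_v ('D_u f) p = 'D_u ('D_v f) p.
Proof.
move=> oO [df d2f] Op.
have nO x : O x -> \forall y \near x, O y by move=> Ox; exact: open_nbhs_nbhs.
have d1 w x : O x -> is_derive x w f ('D_w f x).
  by move=> /df dfx; apply: derivableP; exact: diff_derivable.
have d2 w z x : O x -> is_derive x z ('D_w f) ('D_z ('D_w f) x).
  move=> Ox; apply: derivableP; apply: diff_derivable.
  by have [+ _] := d2f w; exact.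
have e1 i w x : O x -> 'D_w (fun y => f y 0 i) x = 'D_w f x 0 i.
  by move=> /(d1 w) /is_derive_row /(_ i) [].
have e2 i w z x : O x ->
    is_derive x z ('D_w (fun y => f y 0 i)) ('D_z ('D_w f) x 0 i).
  move=> Ox; apply: (@near_eq_is_derive _ _ _ (fun y => 'D_w f y 0 i)).
    by near=> y; rewrite e1//; near: y; exact: nO.
  by move: (d2 w z x Ox) => /is_derive_row; exact.
have c2 i w z : {for p, continuous ('D_z ('D_w (fun y => f y 0 i)))}.
  have cf : {for p, continuous ('D_z ('D_w f))}.
    by have [_ cf] := d2f w; exact: (cf z p Op).
  apply: (@cvg_trans _ ((fun y => 'D_z ('D_w f) y 0 i) @ p)).
    apply: near_eq_cvg; near=> y.
    by have [|_ ->//] := e2 i w z y _; near: y; exact: nO.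
  have [_ ->] := e2 i w z p Op.
  exact: cvg_coord cf.
apply/rowP => i.
have [_ uvE] := e2 i u v p Op; have [_ vuE] := e2 i v u p Op.
apply: (etrans (esym uvE)); apply: (etrans _ vuE).
apply: schwarz_scalar; [|exact: c2|exact: c2].
near=> x.
have Ox : O x by near: x; exact: nO.
split.
- by have /is_derive_row /(_ i) [] := d1 u x Ox.
- by have /is_derive_row /(_ i) [] := d1 v x Ox.
- by have [] := e2 i u v x Ox.
- by have [] := e2 i v u x Ox.
Unshelve. all: by end_near. Qed.

End Schwarz.

(** * Gradients of the Lagrangian *)

Section Gradients.
Context {R : realType} {n : nat}.
Local Notation lift := (R * 'rV[R]_n * 'rV[R]_n)%type.

Lemma derive_gradient (f : 'rV[R]_n -> R) (x y : 'rV[R]_n) :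
  differentiable f x -> 'D_y f x = dotv (gradient f x) y.
Proof.
move=> df; rewrite deriveE// {1}(row_sum_delta y) linear_sum.
by apply: eq_bigr => i _; rewrite linearZ mxE deriveE// mulrC.
Qed.

(** This and [dL_v_coord] give the coordinates of the partial gradients as
    directional derivatives of L itself, to which the smoothness hypothesis on
    L applies. *)
Lemma dL_q_coord (L : lift -> R) t x v i :
  dL_q L t x v 0 i = 'D_((0, delta_mx 0 i, 0) : lift) L (t, x, v).
Proof.
rewrite mxE.
apply: (derive_affine L (g := fun y => (t, y, v))) => h.
by congr (_, _, _); rewrite /= scaler0 add0r.
Qed.

Lemma dL_v_coord (L : lift -> R) t x v i :
  dL_v L t x v 0 i = 'D_((0, 0, delta_mx 0 i) : lift) L (t, x, v).
Proof.
rewrite mxE.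
apply: (derive_affine L (g := fun y => (t, x, y))) => h.
by congr (_, _, _); rewrite /= scaler0 add0r.
Qed.

Lemma derive_lagrangian (L : lift -> R) t x v y z :
  differentiable L (t, x, v) ->
  'D_((0, y, z) : lift) L (t, x, v) =
  dotv (dL_q L t x v) y + dotv (dL_v L t x v) z.
Proof.
move=> dL.
have -> : ((0, y, z) : lift) = (0, y, 0) + (0, 0, z).
  by congr (_, _, _); rewrite /= ?addr0 ?add0r.
rewrite deriveE// linearD -!deriveE//; congr (_ + _).
  rewrite -derive_gradient.
    apply/esym/(derive_affine L (g := fun y => (t, y, v))) => h.
    by congr (_, _, _); rewrite /= scaler0 add0r.
  have dg : differentiable (fun y : 'rV[R]_n => (t, y, v)) x.
    by apply: differentiable_pair => //; exact: differentiable_pair.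
  exact: (differentiable_comp dg).
rewrite -derive_gradient.
  apply/esym/(derive_affine L (g := fun z => (t, x, z))) => h.
  by congr (_, _, _); rewrite /= scaler0 add0r.
have dg : differentiable (fun z : 'rV[R]_n => (t, x, z)) v.
  exact: differentiable_pair.
exact: (differentiable_comp dg).
Qed.

End Gradients.

(** * Differentiation under the integral sign *)

Section Integral.
Context {R : realType}.
Local Notation eps_dir := ((1, 0) : R * R).
Local Notation mu := (@lebesgue_measure R).

(** All hypotheses are local at the points of the compact {e0} x [a, b]; they
    extend to a strip ]e0 - d, e0 + d[ x [a, b], on which the derivative is
    moreover bounded by a constant.  That constant is the integrable majorant
    of dominated convergence. *)
Lemma is_derive_integral (f : R * R -> R) (a b e0 : R) :
  (forall t, t \in `[a, b]%R -> \forall p \near (e0, t),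
     derivable f p eps_dir /\ {for p, continuous f}) ->
  (forall t, t \in `[a, b]%R ->
     {for (e0, t), continuous ('D_eps_dir f)}) ->
  is_derive e0 1 (fun e => (\int[mu]_(t in `[a, b]) f (e, t))%R)
    (\int[mu]_(t in `[a, b]) 'D_eps_dir f (e0, t))%R.
Proof.
move=> df cDf.
have cab : compact `[a, b]%classic := @segment_compact R a b.
(* The bound M is treated as a second parameter that tends to +oo, so that a
   single covering argument yields both the width of the strip and a bound of
   the derivative on it. *)
pose P (eM : R * R) (t : R) := [/\ derivable f (eM.1, t) eps_dir,
   {for (eM.1, t), continuous f} & `|'D_eps_dir f (eM.1, t)| <= eM.2].
have [|[A B] /= [Ae0 Boo] AB] := (compact_near_coveringP _).1 cab (R * R)%type
    (filter_prod (nbhs e0) (+oo)) P _.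
  move=> t tab.
  set D := 'D_eps_dir f.
  have bD : \forall p \near (e0, t), `|D p| <= `|D (e0, t)| + 1.
    have /cvgrPdist_le /(_ _ ltr01) := cDf t tab.
    apply: filterS => p; rewrite distrC => pD.
    rewrite -(subrK (D (e0, t)) (D p)) (le_trans (ler_normD _ _))//.
    by rewrite addrC lerD2l.
  have [[A B] /= [Ae Bt] AB] := filterI (df t tab) bD.
  exists (B, A `*` [set M | `|D (e0, t)| + 1 <= M]) => /=.
    split=> //; exists (A, [set M | `|D (e0, t)| + 1 <= M]) => //=.
    by split=> //; apply: nbhs_pinfty_ge; exact: num_real.
  move=> [s [e M]] /= [Bs [Ae' leM]].
  have [[dfp cfp] Dp] := AB (e, s) (conj Ae' Bs).
  by split=> //=; exact: le_trans leM.
have [M BM] := filter_ex Boo.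
have /nbhs_ballP[d /= d0 dA] := Ae0.
have Pe e t : e \in `]e0 - d, e0 + d[%R -> t \in `[a, b]%R -> P (e, M) t.
  move=> ed tab; apply: (AB (e, M)) => //; split => //; apply: dA.
  by move: ed; rewrite in_itv /= /ball /= ltr_distlC.
have e0d : e0 \in `]e0 - d, e0 + d[%R by rewrite in_itv /= ltrBlDr !ltrDl d0.
have intf e : `]e0 - d, e0 + d[%classic e ->
    mu.-integrable `[a, b] (EFin \o (fun t => f (e, t))).
  move=> ed; apply: continuous_compact_integrable => //.
  apply: continuous_in_subspaceT => t /set_mem tab.
  have [_ cf _] := Pe e t ed tab.
  apply: (@continuous_comp _ _ _ (fun t => (e, t)) f) => //.
  apply: differentiable_continuous; exact: differentiable_pair.
have d1f e t : `]e0 - d, e0 + d[%classic e -> `[a, b]%classic t ->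
    derivable (fun x => f (x, t)) e 1.
  move=> ed tab; have [dft _ _] := Pe e t ed tab.
  by have [] := is_derive_fst_slice dft.
have M0 : 0 <= `|M| by [].
have intM : mu.-integrable `[a, b] (EFin \o (cst `|M|)).
  apply: continuous_compact_integrable => //.
  by apply: continuous_in_subspaceT => t _; exact: cvg_cst.
have ubM e t : `]e0 - d, e0 + d[%classic e -> `[a, b]%classic t ->
    `|partial1of2 (fun e t => f (e, t)) e t| <= cst `|M| t.
  move=> ed tab; rewrite /partial1of2 derive_fst_slice.
  have [_ _ /= fM] := Pe e t ed tab.
  by rewrite (le_trans fM)// ler_norm.
have int := @derivable_under_integral _ _ _ _ _ _ _ _ _ _ e0d intf d1f
  (fun=> `|M|) (fun=> M0) intM ubM.
have intE := @differentiation_under_integral _ _ _ _ _ _ _ _ _ _ e0d intf d1f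
  (fun=> `|M|) (fun=> M0) intM ubM.
split; first by apply: int.
rewrite -derive1E intE; last exact: measurable_itv.
by apply: eq_Rintegral => t _; rewrite /partial1of2 derive_fst_slice.
Qed.

End Integral.

(** * First variation of the action *)

Section Variation.
Context {R : realType} {n : nat}.
Local Notation mu := (@lebesgue_measure R).
Local Notation eps_dir := ((1, 0) : R * R).
Local Notation t_dir := ((0, 1) : R * R).

(** The lift of the curves Q (eps, _), as one function of (eps, t), so that its
    regularity in both variables follows from that of Q. *)
Definition jet (Q : R * R -> 'rV[R]_n) (p : R * R) : R * 'rV[R]_n * 'rV[R]_n :=
  (p.2, Q p, 'D_t_dir Q p).

Definition momentum (L : R * 'rV[R]_n * 'rV[R]_n -> R) (Q : R * R -> 'rV[R]_n)
    (e t : R) : R :=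
  dotv (dL_v L t (Q (e, t)) ('D_t_dir Q (e, t))) ('D_eps_dir Q (e, t)).

Variables (D : set (R * 'rV[R]_n * 'rV[R]_n)).
Variables (L : R * 'rV[R]_n * 'rV[R]_n -> R).
Variables (O : set (R * R)) (Q : R * R -> 'rV[R]_n).
Hypotheses (D_open : open D) (L_smooth : smooth_on D L).
Hypotheses (O_open : open O) (Q_smooth : smooth_on O Q).

Let Q_diff p : O p -> differentiable Q p.
Proof. by have [+ _] := Q_smooth 1; exact. Qed.

Let DQ_diff w p : O p -> differentiable ('D_w Q) p.
Proof. by have [_ dQ] := Q_smooth 2; have [+ _] := dQ w; exact. Qed.

Let DDQ_cont w z p : O p -> {for p, continuous ('D_z ('D_w Q))}.
Proof.
by have [_ dQ] := Q_smooth 2; have [_ cQ] := dQ w => Op; exact: (cQ z p Op).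
Qed.

Let L_diff x : D x -> differentiable L x.
Proof. by have [+ _] := L_smooth 1; exact. Qed.

Let DL_diff w x : D x -> differentiable ('D_w L) x.
Proof. by have [_ dL] := L_smooth 2; have [+ _] := dL w; exact. Qed.

Let snd_diff (p : R * R) : differentiable (snd : R * R -> R) p.
Proof. by apply: linear_differentiable => x; exact: cvg_snd. Qed.

Lemma differentiable_jet p : O p -> differentiable (jet Q) p.
Proof.
move=> Op; apply: differentiable_pair; last exact: DQ_diff.
by apply: differentiable_pair; [exact: snd_diff|exact: Q_diff].
Qed.

Lemma derive_jet w p : O p ->
  'D_w (jet Q) p = (w.2, 'D_w Q p, 'D_w ('D_t_dir Q) p).
Proof.
move=> Op; rewrite derive_pair; last exact: DQ_diff.
  rewrite derive_pair; [|exact: snd_diff|exact: Q_diff].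
  rewrite (deriveE w (snd_diff p)) diff_lin// => x; exact: cvg_snd.
by apply: differentiable_pair; [exact: snd_diff|exact: Q_diff].
Qed.

Lemma near_jet_domain p : O p -> D (jet Q p) ->
  \forall p' \near p, O p' /\ D (jet Q p').
Proof.
move=> Op Dp; apply: filterI; first exact: open_nbhs_nbhs.
have /differentiable_continuous := differentiable_jet Op.
by apply; exact: open_nbhs_nbhs.
Qed.

(** The eps-derivative of [jet Q] has zero time component, so only the gradients
    in position and velocity contribute. *)
Lemma first_variation p : O p -> D (jet Q p) ->
  'D_eps_dir (fun p => L (jet Q p)) p =
  dotv (dL_q L p.2 (Q p) ('D_t_dir Q p)) ('D_eps_dir Q p) +
  dotv (dL_v L p.2 (Q p) ('D_t_dir Q p)) ('D_eps_dir ('D_t_dir Q) p).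
Proof.
move=> Op Dp.
rewrite derive_comp; [|exact: differentiable_jet|exact: L_diff].
by rewrite derive_jet// derive_lagrangian//; exact: L_diff.
Qed.

Lemma differentiable_lagrangian_jet p : O p -> D (jet Q p) ->
  differentiable (fun p => L (jet Q p)) p.
Proof.
move=> Op Dp.
exact: (differentiable_comp (differentiable_jet Op) (L_diff Dp)).
Qed.

Lemma differentiable_DL_jet w p : O p -> D (jet Q p) ->
  differentiable (fun p => 'D_w L (jet Q p)) p.
Proof.
move=> Op Dp.
exact: (differentiable_comp (differentiable_jet Op) (DL_diff w Dp)).
Qed.

Lemma continuous_first_variation p : O p -> D (jet Q p) ->
  {for p, continuous ('D_eps_dir (fun p => L (jet Q p)))}.
Proof.
move=> Op Dp; rewrite /prop_for /continuous_at (first_variation Op Dp).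
have nD := near_jet_domain Op Dp.
apply: (@cvg_trans _ ((fun p =>
  dotv (dL_q L p.2 (Q p) ('D_t_dir Q p)) ('D_eps_dir Q p) +
  dotv (dL_v L p.2 (Q p) ('D_t_dir Q p)) ('D_eps_dir ('D_t_dir Q) p)) @ p)).
  apply: near_eq_cvg; near=> p'.
  have [Op' Dp'] : O p' /\ D (jet Q p') by near: p'; exact: nD.
  by rewrite (first_variation Op' Dp').
apply: (@cvgD _ _ _ (nbhs p)); apply: cvg_dotv => i.
- under eq_cvg do rewrite dL_q_coord.
  rewrite dL_q_coord.
  exact: (differentiable_continuous (differentiable_DL_jet _ Op Dp)).
- apply: cvg_coord; exact: (differentiable_continuous (DQ_diff _ Op)).
- under eq_cvg do rewrite dL_v_coord.
  rewrite dL_v_coord.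
  exact: (differentiable_continuous (differentiable_DL_jet _ Op Dp)).
- apply: cvg_coord; exact: (DDQ_cont (w := t_dir) (z := eps_dir) Op).
Unshelve. all: by end_near. Qed.

(** By the product rule, the derivative of the momentum is
    (d/dt) dL_v . (dQ/d eps) + dL_v . (d/dt) (dQ/d eps).  The Lagrange equation,
    assumed here only at t, turns the first term into dL_q . (dQ/d eps), and
    symmetry of the second derivatives turns the second into
    dL_v . (d/d eps) (dQ/dt): this is the first variation of L. *)
Lemma is_derive_momentum e t : O (e, t) -> D (jet Q (e, t)) ->
  (fun s => dL_v L s (Q (e, s)) ('D_t_dir Q (e, s)))^`() t =
    dL_q L t (Q (e, t)) ('D_t_dir Q (e, t)) ->
  is_derive t 1 (momentum L Q e) ('D_eps_dir (fun p => L (jet Q p)) (e, t)).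
Proof.
move=> Op Dp lagrange; rewrite (first_variation Op Dp) -lagrange derive1E.
have -> : 'D_eps_dir ('D_t_dir Q) (e, t) = 'D_t_dir ('D_eps_dir Q) (e, t).
  exact: (schwarz_row t_dir eps_dir O_open (Q_smooth 2) Op).
apply: is_derive_dotv; last first.
  by apply: is_derive_snd_slice; apply: diff_derivable; exact: DQ_diff.
apply: derivableP; apply/derivable_mxP => i j; rewrite ord1.
under eq_fun do rewrite dL_v_coord.
have dp : derivable (fun p => 'D_(0, 0, delta_mx 0 j) L (jet Q p)) (e, t) t_dir.
  by apply: diff_derivable; exact: differentiable_DL_jet.
by have [] := is_derive_snd_slice dp.
Qed.

(** The derivative of the action is the integral of the first variation, whose
    primitive along an extremal is the momentum. *)
Lemma is_derive_action (a b e0 : R) : a < b ->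
  (forall t, a <= t <= b -> O (e0, t) /\ D (jet Q (e0, t))) ->
  (forall t, a <= t <= b ->
    (fun s => dL_v L s (Q (e0, s)) ('D_t_dir Q (e0, s)))^`() t =
    dL_q L t (Q (e0, t)) ('D_t_dir Q (e0, t))) ->
  is_derive e0 1 (fun e => action L a b (fun t => Q (e, t)))
    (momentum L Q e0 b - momentum L Q e0 a).
Proof.
move=> ab OD lagrange.
have -> : (fun e => action L a b (fun t => Q (e, t))) =
    (fun e => (\int[mu]_(t in `[a, b]) L (jet Q (e, t)))%R).
  apply/funext => e; rewrite /action /oriented_integral (ltW ab).
  by apply: eq_Rintegral => t _; rewrite derive_snd_slice.
have dm t : a <= t <= b -> is_derive t 1 (momentum L Q e0)
    ('D_eps_dir (fun p => L (jet Q p)) (e0, t)).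
  move=> abt; have [Op Dp] := OD t abt.
  exact: is_derive_momentum (lagrange t abt).
have <- : (\int[mu]_(t in `[a, b])
    'D_eps_dir (fun p => L (jet Q p)) (e0, t))%R =
    momentum L Q e0 b - momentum L Q e0 a.
  have cm t : a <= t <= b -> {for t, continuous (momentum L Q e0)}.
    move=> abt; apply/differentiable_continuous/derivable1_diffP.
    by have [] := dm t abt.
  rewrite /Rintegral (@continuous_FTC2 _ _ (momentum L Q e0))//.
  - apply: continuous_in_subspaceT => t /set_mem; rewrite /= in_itv /= => abt.
    have [Op Dp] := OD t abt.
    apply: (@continuous_comp _ _ _ (fun t => (e0, t))
      ('D_eps_dir (fun p => L (jet Q p)))).
      by apply: differentiable_continuous; exact: differentiable_pair.
    exact: continuous_first_variation.
  - split.
    + move=> t; rewrite in_itv /= => /andP[at_ tb].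
      by have [] := dm t _; rewrite ?ltW.
    + by apply: cvg_at_right_filter; apply: cm; rewrite lexx ltW.
    + by apply: cvg_at_left_filter; apply: cm; rewrite lexx ltW.
  - move=> t; rewrite in_itv /= => /andP[at_ tb].
    by rewrite derive1E; have [|_ ->] := dm t _; rewrite ?ltW.
apply: (@is_derive_integral R (fun p => L (jet Q p)) a b e0) => t;
  rewrite in_itv /= => abt.
  have [Op Dp] := OD t abt; have nD := near_jet_domain Op Dp; near=> p.
  have [Op' Dp'] : O p /\ D (jet Q p) by near: p; exact: nD.
  have dp := differentiable_lagrangian_jet Op' Dp'.
  by split; [exact: diff_derivable|exact: differentiable_continuous].
by have [Op Dp] := OD t abt; exact: continuous_first_variation.
Unshelve. all: by end_near. Qed.

End Variation.

Theorem theorem2 (R : realType) (n : nat) (n_ge1 : (1 <= n)%N)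
  (D : set (R * 'rV[R]_n * 'rV[R]_n)) (L : R * 'rV[R]_n * 'rV[R]_n -> R)
  (D_open : open D) (L_smooth : smooth_on D L)
  (I : set R) (I_open : open I) (I_interval : is_interval I)
  (q : R -> 'rV[R]_n) (q_traj : is_trajectory D I q)
  (qe : R -> R -> 'rV[R]_n) (qe_change : space_change I q qe)
  (G : R -> R -> R) (G_BH : BH_function I G)
  (inv : infinitesimal_BH_invariance L I qe G)
  (q_sol : lagrange_solution L I q) :
  exists c : R, forall t : R, I t ->
    dotv (dL_v L t (q t) (derive1 q t)) (derive1 (fun eps => qe eps t) 0)
      + derive1 (fun eps => G eps t) 0 = c.
Proof.
have [[U [[U_open IU _] Q_smooth]] qe0] := qe_change.
have [U' [[_ IU' _] G_smooth]] := G_BH.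
have [_ qD] := q_traj.
pose Q (p : R * R) := qe p.1 p.2.
have UI t : I t -> U (0, t) by move=> It; exact: IU.
have nearI t : I t -> \forall s \near t, I s.
  by move=> It; exact: open_nbhs_nbhs.
have Q0 t : I t -> Q (0, t) = q t by move=> It; rewrite /Q /= qe0.
(* The values at eps = 0 of Q and of its time derivative are those of q on I;
   for the derivative this uses that I is open. *)
have qeE t : I t -> 'D_((0, 1) : R * R) Q (0, t) = derive1 q t.
  move=> It; rewrite -derive_snd_slice !derive1E.
  apply: near_eq_derive; near=> s.
  by rewrite Q0//; near: s; exact: nearI.
have jetE t : I t -> jet Q (0, t) = (t, q t, derive1 q t).
  by move=> It; rewrite /jet qeE// Q0.
have lagrange t : I t ->
    derive1 (fun s => dL_v L s (Q (0, s)) ('D_((0, 1) : R * R) Q (0, s))) t =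
    dL_q L t (Q (0, t)) ('D_((0, 1) : R * R) Q (0, t)).
  move=> It; rewrite (qeE t It) (Q0 t It).
  have /eqP := q_sol t It; rewrite subr_eq0 => /eqP <-.
  rewrite [LHS]derive1E [RHS]derive1E; apply: near_eq_derive; near=> s.
  have Is : I s by near: s; exact: nearI.
  by rewrite qeE// Q0.
have dG t : I t -> is_derive (0 : R) 1 (fun eps => G eps t)
    (derive1 (fun eps => G eps t) 0).
  move=> It; rewrite derive1E; apply: derivableP.
  have dG : differentiable (fun p : R * R => G p.1 p.2) (0, t).
    by have [+ _] := G_smooth 1; apply; exact: IU'.
  by have [] := is_derive_fst_slice (diff_derivable (v := (1, 0) : R * R) dG).
pose charge t := dotv (dL_v L t (q t) (derive1 q t))
  (derive1 (fun eps => qe eps t) 0) + derive1 (fun eps => G eps t) 0.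
have conserved a b : I a -> I b -> a < b -> charge a = charge b.
  move=> Ia Ib ab.
  have Iab t : a <= t <= b -> I t by move=> abt; exact: I_interval abt.
  have dA : is_derive (0 : R) 1 (fun eps => action L a b (qe eps))
      (momentum L Q 0 b - momentum L Q 0 a).
    apply: (is_derive_action D_open L_smooth U_open Q_smooth ab) => t /Iab It.
      by rewrite jetE//; split; [exact: UI|exact: qD].
    exact: lagrange.
  have dS := is_deriveB (is_deriveD dA (dG b Ib)) (dG a Ia).
  have [_ S0] := inv a b Ia Ib; have [_ SE] := dS.
  have := etrans (esym SE) S0.
  rewrite /momentum !qeE// !Q0// -!derive_fst_slice /Q /= => balance.
  have regroup (x y z w : R) : x - y + z - w = 0 -> y + w = x + z.
    by move=> xyzw; apply/esym/subr0_eq; rewrite -xyzw; ring.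
  exact: regroup balance.
have [[t0 It0]|I0] := pselect (exists t, I t); last first.
  by exists 0 => t It; exfalso; apply: I0; exists t.
exists (charge t0) => t It.
by have [/conserved|/conserved|->] := ltgtP t t0; [exact|move=> /(_ It0 It)|].
Unshelve. all: by end_near. Qed.
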